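(* Let $n\ge 2$, let $W$ be the Coxeter group of type $\tilde A_{n-1}$ and let $c$ be any Coxeter element of $W$. The monoid $M(P_c)$ is presented by the generators $\underline r$, where $r$ runs over the reflections of $W$ dividing $c$, subject to the relations $$\underline r.\underline t=\underline{rtr}.\underline r$$ for all pairs $(r,t)$ of distinct reflections such that $rt$ divides $c$.
   Context: Let $W$ be the Coxeter group of type $\tilde A_{n-1}$ with Coxeter generators $s_1,\dots,s_n$, where $s_i$ and $s_{i+1}$ are joined in the Coxeter diagram (indices mod $n$). Let $R$ be the set of reflections (conjugates of the $s_i$). For $w\in W$ let $l_R(w)$ be the least number of factors in an expression of $w$ as a product of elements of $R$. For $v,w\in W$, $v$ divides $w$ if $w=vv'$ with $l_R(w)=l_R(v)+l_R(v')$ (equivalently, as $R$ is stable under conjugation, $w=v''v$ with $l_R(w)=l_R(v'')+l_R(v)$). A Coxeter element $c$ is a product of all the $s_i$, each occurring once, in an arbitrary order. $P_c$ is the set of divisors of $c$. $M(P_c)$ is the monoid generated by a set $\underline P_c=\{\underline w\mid w\in P_c\}$ in bijection with $P_c$, with relations $\underline w.\underline{w'}=\underline{ww'}$ whenever $w,w',ww'\in P_c$ and $l_R(ww')=l_R(w)+l_R(w')$. (If $r,t$ are distinct reflections with $rt\in P_c$, then $r$, $t$ and $rtr$ are all in $R\cap P_c$.)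
   Formalization: In M(P_c) the generator attached to the identity of W is additionally set equal to the unit of the monoid; with the product relations alone it would be a non-unit idempotent, not a product of reflections, and the claim would fail. *)

(* Defs.v *)
From HB Require Import structures.
From mathcomp Require Import all_boot.
From mathcomp Require Import boolp classical_sets.

Set Implicit Arguments.
Unset Strict Implicit.
Unset Printing Implicit Defensive.

Local Open Scope group_scope.
Local Open Scope quotient_scope.

Section PresentedMonoid.
Variables (X : choiceType) (rel : seq X -> seq X -> Prop).

Inductive word_cong : seq X -> seq X -> Prop :=
| word_cong_rel a b u v : rel u v -> word_cong (a ++ u ++ b) (a ++ v ++ b)
| word_cong_refl u : word_cong u u
| word_cong_sym u v : word_cong u v -> word_cong v u
| word_cong_trans u v w : word_cong u v -> word_cong v w -> word_cong u w.

Definition word_congb (u v : seq X) : bool := `[< word_cong u v >].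

Lemma word_congb_refl : reflexive word_congb.
Proof. by move=> u; apply/asboolP; apply: word_cong_refl. Qed.

Lemma word_congb_sym : symmetric word_congb.
Proof. by move=> u v; apply/asboolP/asboolP => /word_cong_sym. Qed.

Lemma word_congb_trans : transitive word_congb.
Proof.
by move=> v u w /asboolP uv /asboolP vw; apply/asboolP; apply: word_cong_trans vw.
Qed.

Canonical word_congb_equiv :=
  EquivRel word_congb word_congb_refl word_congb_sym word_congb_trans.

(* The monoid < X | u = v for (u, v) in rel >. *)
Definition pmonoid := {eq_quot word_congb}.

HB.instance Definition _ := Choice.on pmonoid.

Definition pword (w : seq X) : pmonoid := \pi_{eq_quot word_congb} w.
Definition pgen (x : X) : pmonoid := pword [:: x].

Lemma pwordP u v : pword u = pword v <-> word_cong u v.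
Proof. by split=> [/eqmodP/asboolP//|uv]; apply/eqmodP/asboolP. Qed.

Lemma pword_repr (x : pmonoid) : pword (repr x) = x.
Proof. exact: reprK. Qed.

Lemma pword_surj (x : pmonoid) : exists w, x = pword w.
Proof. by exists (repr x); rewrite pword_repr. Qed.

Lemma word_cong_cat u u' v v' :
  word_cong u u' -> word_cong v v' -> word_cong (u ++ v) (u' ++ v').
Proof.
have catl a w w' : word_cong w w' -> word_cong (a ++ w) (a ++ w').
  elim=> {w w'}.
  - by move=> b c w w' h; rewrite !(catA a b); apply: word_cong_rel.
  - by move=> *; apply: word_cong_refl.
  - by move=> *; apply: word_cong_sym.
  - by move=> ? ? ? _ h1 _ h2; apply: word_cong_trans h1 h2.
have catr b w w' : word_cong w w' -> word_cong (w ++ b) (w' ++ b).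
  elim=> {w w'}.
  - by move=> a c w w' h; rewrite -!catA; apply: word_cong_rel.
  - by move=> *; apply: word_cong_refl.
  - by move=> *; apply: word_cong_sym.
  - by move=> ? ? ? _ h1 _ h2; apply: word_cong_trans h1 h2.
by move=> uu' vv'; apply: word_cong_trans (catl _ _ _ vv'); apply: catr.
Qed.

Definition pmul (x y : pmonoid) : pmonoid := pword (repr x ++ repr y).

Lemma pmul_word u v : pmul (pword u) (pword v) = pword (u ++ v).
Proof. by apply/pwordP/word_cong_cat; apply/pwordP; rewrite /pword reprK. Qed.

Lemma pmulA : associative pmul.
Proof.
move=> x y z.
have [u ->] := pword_surj x; have [v ->] := pword_surj y.
by have [w ->] := pword_surj z; rewrite !pmul_word catA.
Qed.

Lemma pmul1g : left_id (pword [::]) pmul.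
Proof. by move=> x; have [u ->] := pword_surj x; rewrite pmul_word. Qed.

Lemma pmulg1 : right_id (pword [::]) pmul.
Proof. by move=> x; have [u ->] := pword_surj x; rewrite pmul_word cats0. Qed.

HB.instance Definition _ := isMonoid.Build pmonoid pmulA pmul1g pmulg1.

Lemma pwordM u v : pword (u ++ v) = pword u * pword v.
Proof. by rewrite -pmul_word. Qed.

Lemma pword_prod w : pword w = \prod_(x <- w) pgen x.
Proof.
by elim: w => [|x w IHw]; rewrite ?big_nil // big_cons -IHw -pwordM.
Qed.

End PresentedMonoid.

Definition presented_by (M : monoidType) (X : choiceType) (g : X -> M)
    (rel : seq X -> seq X -> Prop) : Prop :=
  exists phi : pmonoid rel -> M,
    [/\ monoid_morphism phi, bijective phi & forall x, phi (pgen rel x) = g x].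

(* Group presentations: words over X + X, where inr x stands for the formal
   inverse of inl x, modulo free cancellation and the relators. *)
Section PresentedGroup.
Variables (X : choiceType) (relator : seq (X + X) -> Prop).

Definition linv (l : X + X) : X + X :=
  match l with inl x => inr x | inr x => inl x end.

Inductive group_rel : seq (X + X) -> seq (X + X) -> Prop :=
| group_rel_cancel l : group_rel [:: l; linv l] [::]
| group_rel_relator u : relator u -> group_rel u [::].

Definition pgroup := pmonoid group_rel.

HB.instance Definition _ := Monoid.on pgroup.

Definition ggen (x : X) : pgroup := pgen group_rel (inl x).

Definition winv (w : seq (X + X)) := rev (map linv w).

Lemma linvK : involutive linv. Proof. by case. Qed.

Lemma winvK : involutive winv.
Proof. by move=> w; rewrite /winv map_rev revK mapK //; apply: linvK. Qed.

Lemma pwordV w : pword group_rel (w ++ winv w) = 1.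
Proof.
elim: w => // l w IHw.
have -> : (l :: w) ++ winv (l :: w) = [:: l] ++ (w ++ winv w) ++ [:: linv l].
  by rewrite /winv /= rev_cons -cats1 -catA.
rewrite 2!pwordM IHw mul1g -pwordM; apply/pwordP.
exact: (word_cong_rel [::] [::] (group_rel_cancel l)).
Qed.

Definition ginv (x : pgroup) : pgroup := pword group_rel (winv (repr x)).

Lemma gmulVg : left_inverse 1 ginv *%g.
Proof.
move=> x; rewrite -[X in _ * X]pword_repr -pwordM.
by rewrite -[X in _ ++ X]winvK pwordV.
Qed.

Lemma gmulgV : right_inverse 1 ginv *%g.
Proof.
by move=> x; rewrite -[X in X * _]pword_repr -pwordM pwordV.
Qed.

HB.instance Definition _ := hasInv.Build pgroup ginv.
HB.instance Definition _ := Monoid_isGroup.Build pgroup gmulVg gmulgV.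

End PresentedGroup.

Section CoxeterGroup.
(* Coxeter matrix; the value 0 encodes infinity, the relator being empty. *)
Variables (I : choiceType) (m : I -> I -> nat).

Definition coxeter_relator (u : seq (I + I)) : Prop :=
  exists i j, u = flatten (nseq (m i j) [:: inl i; inl j]).

Definition coxeter_group := pgroup coxeter_relator.

HB.instance Definition _ := Group.on coxeter_group.

Definition sgen (i : I) : coxeter_group := ggen coxeter_relator i.

End CoxeterGroup.

(* Affine type A_{n-1} tilde on the cycle Z/n; for n = 2 the two generators are
   joined by an edge labelled infinity. *)
Definition affineA_matrix (n : nat) (i j : 'I_n) : nat :=
  (if i == j then 1
   else if (j == ordS i) || (i == ordS j) then (if n == 2 then 0 else 3)
   else 2)%N.

Definition affineA (n : nat) := coxeter_group (@affineA_matrix n).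

HB.instance Definition _ n := Group.on (affineA n).

Section AffineA.
Variable n : nat.
Implicit Types (v w c r t : affineA n).

Definition cgen (i : 'I_n) : affineA n := sgen (@affineA_matrix n) i.

Definition reflection t : Prop := exists i w, t = cgen i ^ w.

Definition reflection_word (ts : seq (affineA n)) w : Prop :=
  (forall t, t \in ts -> reflection t) /\ w = \prod_(t <- ts) t.

Lemma cgenV i : (cgen i)^-1 = cgen i.
Proof.
suff h : cgen i * cgen i = 1 by rewrite -[LHS]mul1g -h mulgK.
rewrite -[_ * _]/(pword _ [:: inl i] * pword _ [:: inl i]) -pwordM.
apply/pwordP; apply: (@word_cong_rel _ _ [::] [::] [:: inl i; inl i] [::]).
by apply: group_rel_relator; exists i, i; rewrite /affineA_matrix eqxx.
Qed.

Lemma reflection_word_exists w :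
  exists k, `[< exists2 ts, size ts = k & reflection_word ts w >].
Proof.
suff [ts tsw] : exists ts, reflection_word ts w.
  by exists (size ts); apply/asboolP; exists ts.
have [u ->] := pword_surj w; rewrite pword_prod.
elim: u => [|l u [ts [tsR tsE]]]; first by exists [::]; split=> //; rewrite !big_nil.
have [i iE] : exists i, pgen (group_rel (coxeter_relator (@affineA_matrix n))) l
    = cgen i.
  case: l => i; exists i => //.
  suff h : pgen _ (inr i) * cgen i = 1.
    by rewrite -[RHS]cgenV -[RHS]mul1g -h mulgK.
  rewrite -[_ * _]/(pword _ [:: inr i] * pword _ [:: inl i]) -pwordM.
  apply/pwordP; apply: (@word_cong_rel _ _ [::] [::] [:: inr i; inl i] [::]).
  exact: (group_rel_cancel _ (inr i)).
exists (cgen i :: ts); split=> [t|]; last by rewrite !big_cons -tsE iE.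
by rewrite inE => /orP[/eqP->|/tsR//]; exists i, 1; rewrite conjg1.
Qed.

Definition reflection_length w : nat := ex_minn (reflection_word_exists w).

Definition divides v w : Prop :=
  exists2 v', w = v * v' &
    reflection_length w = (reflection_length v + reflection_length v')%N.

Definition coxeter_element c : Prop :=
  exists2 p : seq 'I_n, perm_eq p (enum 'I_n) & c = \prod_(i <- p) cgen i.

Definition divisors c : set (affineA n) := [set v | divides v c].

(* The relations of the monoid M(P_c). By convention the generator attached
   to 1 \in P_c is the unit of M(P_c): the product relations alone make it act
   as a unit on the other generators, but do not identify it with the empty
   word. *)
Inductive dual_rel c : seq (divisors c) -> seq (divisors c) -> Prop :=
| dual_rel_unit (e : divisors c) : val e = 1 -> dual_rel [:: e] [::]
| dual_rel_mul (w w' ww' : divisors c) : val ww' = val w * val w' ->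
    reflection_length (val ww') =
      (reflection_length (val w) + reflection_length (val w'))%N ->
    dual_rel [:: w; w'] [:: ww'].

Definition dual_monoid c := pmonoid (@dual_rel c).

HB.instance Definition _ c := Monoid.on (dual_monoid c).

Definition dual_gen c (w : divisors c) : dual_monoid c := pgen (@dual_rel c) w.

Definition refl_divisors c : set (affineA n) :=
  [set r | reflection r /\ divides r c].

Lemma refl_divisors_sub c (r : refl_divisors c) : val r \in divisors c.
Proof. by apply/mem_set; have /set_mem[] := valP r. Qed.

Definition refl_divisor_in c (r : refl_divisors c) : divisors c :=
  exist _ (val r) (refl_divisors_sub r).

(* When r and t are distinct reflections with rt dividing c, the elements r, t
   and rtr always are reflections dividing c, so that letting the variables range
   over refl_divisors c discards no relation. *)
Inductive hurwitz_rel c : seq (refl_divisors c) -> seq (refl_divisors c) -> Prop :=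
| Hurwitz_rel (r t rtr : refl_divisors c) :
    r <> t -> divides (val r * val t) c -> val rtr = val r * val t * val r ->
    hurwitz_rel [:: r; t] [:: rtr; r].

End AffineA.

(* Main.v *)
Require Import Defs.
From mathcomp Require Import all_boot.
From mathcomp Require Import boolp classical_sets.
From mathcomp Require Import ssralg ssrint ssrnum fingroup perm zify.

Set Implicit Arguments.
Unset Strict Implicit.
Unset Printing Implicit Defensive.

(** The presentations agree because all reduced reflection words of a given
    divisor w of c are related by Hurwitz moves ([hurwitz_transitive]): sending w
    to any of its reduced words is then a well defined inverse of the morphism
    sending a reflection to its generator in the dual monoid.

    The group acts faithfully by affine permutations of the pairs (residue mod n,
    period) ([act_faithful]), a reflection swapping two residues up to an offset.
    A reflection is thus known from the image of one residue that it moves.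

    Transitivity is proved by induction on length. Fix a residue m. Hurwitz moves
    bring the letters moving m to the front, and turn two neighbours that swap m
    with distinct residues into one of them and a letter fixing m, as in the
    symmetric group on three letters ([gather]). If w moves m modulo n, exactly
    one letter moving m survives; as all the letters after it fix m, it is
    determined by w ([first_letter_unique]). Hence two reduced words of w can be
    given the same first letter, which the induction removes.

    There remain the divisors w that act trivially on residues
    ([translation_divisor]). A complement of w in c has the two cycles of c on
    residues, hence length at least n - 2, so that w has length 0 or 2. In the
    latter case the letters of the complement preserve both cycles, and w alone
    must account for the winding number 1 of c along one of them: w translates by
    exactly one period. Its reduced words are the pairs of consecutive reflections
    in an infinite dihedral group, along which Hurwitz moves slide
    ([adjacent_slide]). This also excludes three parallel letters side by side in
    a reduced word, as the last two could be slid so as to cancel the first. *)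

(** * Monoids given by generators and relations *)

Section UniversalProperty.
Local Open Scope group_scope.
Variables (X : choiceType) (rel : seq X -> seq X -> Prop) (M : monoidType) (g : X -> M).
Hypothesis g_rel : forall u v, rel u v -> \prod_(x <- u) g x = \prod_(x <- v) g x.

Definition pmonoid_lift (x : pmonoid rel) : M := \prod_(y <- generic_quotient.repr x) g y.

Lemma pmonoid_lift_pword w : pmonoid_lift (pword rel w) = \prod_(x <- w) g x.
Proof.
have cong u v : word_cong rel u v -> \prod_(x <- u) g x = \prod_(x <- v) g x.
  elim=> {u v} [a b u v uv|//|u v _ -> //|u v w' _ -> _ -> //].
  by rewrite !big_cat (g_rel uv).
by apply: cong; apply/pwordP; rewrite pword_repr.
Qed.

Lemma pmonoid_lift_gen x : pmonoid_lift (pgen rel x) = g x.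
Proof. by rewrite pmonoid_lift_pword big_seq1. Qed.

Lemma pmonoid_lift_morphism : monoid.monoid_morphism pmonoid_lift.
Proof.
split; first by rewrite -[1]/(pword rel [::]) pmonoid_lift_pword big_nil.
move=> x y; have [u ->] := pword_surj x; have [v ->] := pword_surj y.
by rewrite -pwordM !pmonoid_lift_pword big_cat.
Qed.

End UniversalProperty.

Lemma pmonoid_morphism_id (X : choiceType) (rel : seq X -> seq X -> Prop)
    (f : pmonoid rel -> pmonoid rel) :
  monoid.monoid_morphism f -> (forall x, f (pgen rel x) = pgen rel x) -> f =1 id.
Proof.
move=> [f1 fM] f_gen x; have [w ->] := pword_surj x; rewrite pword_prod.
by elim: w => [|y w IHw]; rewrite ?big_nil // big_cons fM f_gen IHw.
Qed.

Lemma monoid_morphism_comp (M N L : monoidType) (f : M -> N) (g : N -> L) :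
  monoid.monoid_morphism f -> monoid.monoid_morphism g ->
  monoid.monoid_morphism (g \o f).
Proof. by move=> [f1 fM] [g1 gM]; split=> [|x y] /=; rewrite ?f1 // fM gM. Qed.
(** * The action by affine permutations *)

Section AffineAction.
Local Open Scope group_scope.
Variable n : nat.
Hypothesis n_gt1 : (1 < n)%N.
Implicit Types (a b i j : 'I_n) (d e k : int) (x y : 'I_n * int).
Implicit Types (u v w t : affineA n).

(** The pair (a, k) stands for the integer a + k n; [aswap a b d] is the affine
    permutation exchanging a + k n with b + (k + d) n for all k. *)
Definition aswap a b d x : 'I_n * int :=
  if x.1 == a then (b, x.2 + d)%R
  else if x.1 == b then (a, x.2 - d)%R else x.

Definition translate k x : 'I_n * int := (x.1, x.2 + k)%R.

Lemma aswapK a b d : a != b -> involutive (aswap a b d).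
Proof.
move=> ab [z k]; rewrite /aswap /=.
case: (eqVneq z a) => [->|za] /=.
  by rewrite eq_sym (negPf ab) eqxx /=; congr pair; lia.
case: (eqVneq z b) => [->|zb] /=; last by rewrite (negPf za) (negPf zb).
by rewrite eqxx; congr pair; lia.
Qed.

Lemma aswapC a b d : a != b -> aswap a b d =1 aswap b a (- d).
Proof.
move=> ab [z k]; rewrite /aswap /=.
case: (eqVneq z a) => [->|za]; first by rewrite (negPf ab) GRing.opprK.
by case: (eqVneq z b).
Qed.

Lemma aswap_translate a b d k x :
  aswap a b d (translate k x) = translate k (aswap a b d x).
Proof.
case: x => z l; rewrite /aswap /translate /=.
by case: (z == a); case: (z == b) => //=; congr pair; lia.
Qed.

Lemma aswap_fix a b d x : x.1 != a -> x.1 != b -> aswap a b d x = x.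
Proof. by rewrite /aswap => /negPf-> /negPf->. Qed.

Lemma aswapL a b d k : aswap a b d (a, k) = (b, k + d)%R.
Proof. by rewrite /aswap /= eqxx. Qed.

Lemma aswapR a b d k : a != b -> aswap a b d (b, k) = (a, k - d)%R.
Proof. by rewrite /aswap /= eq_sym => /negPf->; rewrite eqxx. Qed.

Lemma aswap_fst a b d x : (aswap a b d x).1 = tperm a b x.1.
Proof.
rewrite /aswap; case: tpermP => [->|->|/eqP/negPf-> /eqP/negPf->//].
  by rewrite eqxx.
by case: eqVneq => [->|] //=; rewrite eqxx.
Qed.

(** The last generator closes the cycle: as an affine permutation it swaps the
    residue n - 1 of one period with the residue 0 of the next one. *)
Definition wrap i : int := (i.+1 == n)%:Z.

Definition gact i : 'I_n * int -> 'I_n * int := aswap i (ordS i) (wrap i).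

Lemma ordSE i : ordS i = (if i.+1 == n then 0 else i.+1) :> nat.
Proof.
rewrite /=; have := ltn_ord i.
by case: eqVneq => [->|ni ilt]; rewrite ?modnn ?modn_small //; lia.
Qed.

Lemma ordS_neq i : i != ordS i.
Proof.
by apply/eqP => /(congr1 (@nat_of_ord n)); rewrite ordSE; case: eqVneq; lia.
Qed.

Lemma gactK i : involutive (gact i).
Proof. exact/aswapK/ordS_neq. Qed.

Lemma ordS_inj : injective (@ordS n).
Proof. exact: can_inj (@ordSK n). Qed.

Lemma gact_fix j x : x.1 != j -> x.1 != ordS j -> gact j x = x.
Proof. exact: aswap_fix. Qed.

Lemma gact_comm i j x : i != j -> j != ordS i -> i != ordS j ->
  gact i (gact j x) = gact j (gact i x).
Proof.
move=> ij ji ij'.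
have S1 : ordS i != ordS j by rewrite (inj_eq ordS_inj).
have fixj y : y.1 \in [:: i; ordS i] -> gact j y = y.
  rewrite !inE => /orP[]/eqP E; apply: gact_fix; rewrite E //.
  by rewrite eq_sym.
have inI y : y.1 \in [:: i; ordS i] -> (gact i y).1 \in [:: i; ordS i].
  by rewrite aswap_fst !inE => /orP[]/eqP->; rewrite ?tpermL ?tpermR eqxx ?orbT.
have fixi y : y.1 \notin [:: i; ordS i] -> gact i y = y.
  by rewrite !inE => /norP[]; apply: gact_fix.
have [xi|xi] := boolP (x.1 \in [:: i; ordS i]).
  by rewrite (fixj x) // fixj // inI.
rewrite (fixi x) //; have [yi|/fixi//] := boolP ((gact j x).1 \in [:: i; ordS i]).
by have := fixj _ yi; rewrite gactK => E; rewrite E yi in xi.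
Qed.

Lemma gact_braid i x : n != 2 ->
  gact i (gact (ordS i) (gact i x)) = gact (ordS i) (gact i (gact (ordS i) x)).
Proof.
move=> n2; set j := ordS i; set l := ordS j.
have ij : i != j := ordS_neq i.
have jl : j != l := ordS_neq j.
have il : i != l.
  apply/eqP => /(congr1 (@nat_of_ord n)); rewrite /l ordSE /j ordSE.
  by have := ltn_ord i; case: (i.+1 =P n) => [|_]; case: eqP => /=; lia.
have E0 k : gact i (i, k) = (j, k + wrap i)%R by exact: aswapL.
have E1 k : gact i (j, k) = (i, k - wrap i)%R by exact: aswapR.
have E2 k : gact i (l, k) = (l, k) by apply: aswap_fix; rewrite eq_sym.
have F0 k : gact j (i, k) = (i, k) by exact: aswap_fix.
have F1 k : gact j (j, k) = (l, k + wrap j)%R by exact: aswapL.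
have F2 k : gact j (l, k) = (j, k - wrap j)%R by exact: aswapR.
case: x => z k; have [->|zi] := eqVneq z i; first by rewrite !(E0, F0, F1, E2).
have [->|zj] := eqVneq z j.
  by rewrite !(E0, E1, E2, F0, F1, F2); congr pair; lia.
have [->|zl] := eqVneq z l; first by rewrite !(E1, E2, F0, F2).
have fi : gact i (z, k) = (z, k) by exact: aswap_fix.
have fj : gact j (z, k) = (z, k) by exact: aswap_fix.
by rewrite fi fj fi.
Qed.

Definition lact (l : 'I_n + 'I_n) := gact (match l with inl i => i | inr i => i end).

Definition wordact (q : seq ('I_n + 'I_n)) x := foldl (fun y l => lact l y) x q.

Lemma wordact_cat p q x : wordact (p ++ q) x = wordact q (wordact p x).
Proof. by rewrite /wordact foldl_cat. Qed.

Lemma wordact_relator p : coxeter_relator (@affineA_matrix n) p -> wordact p =1 id.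
Proof.
move=> [i [j ->]] x; rewrite /affineA_matrix.
have [->|ij] := eqVneq i j; first by rewrite /wordact /= /lact gactK.
case: ifPn => [|/norP[]]; last first.
  move=> ji ij'; rewrite /wordact /=.
  by rewrite /lact -gact_comm // !gactK.
have [_ //|n2] := eqVneq n 2.
case/orP => /eqP E; rewrite /wordact /= /lact.
- by rewrite E -gact_braid // !gactK.
- by rewrite E gact_braid // !gactK.
Qed.

Lemma wordact_cong p q :
  word_cong (group_rel (coxeter_relator (@affineA_matrix n))) p q ->
  wordact p =1 wordact q.
Proof.
elim=> {p q} [a b p q [[]i|p' rp]|p|p q _ E|p q r _ E _ F] x //.
- by rewrite !wordact_cat /wordact /= /lact /= gactK.
- by rewrite !wordact_cat /wordact /= /lact /= gactK.
- by rewrite !wordact_cat (wordact_relator rp).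
- by rewrite E F.
Qed.

(** A right action: [u * v] acts by [u] first, as for permutations. *)
Definition act w : 'I_n * int -> 'I_n * int := wordact (generic_quotient.repr w).

Lemma act_pword p : act (pword _ p) =1 wordact p.
Proof. by apply: wordact_cong; apply/pwordP; rewrite pword_repr. Qed.

Lemma actM u v x : act (u * v) x = act v (act u x).
Proof.
by rewrite -[u * v]/(pmul u v) /pmul act_pword wordact_cat.
Qed.

Lemma act1 x : act 1 x = x.
Proof. by rewrite -[1]/(pword _ [::]) act_pword. Qed.

Lemma act_cgen i : act (cgen i) =1 gact i.
Proof. exact: act_pword. Qed.

Lemma actK w : cancel (act w) (act w^-1).
Proof. by move=> x; rewrite -actM mulgV act1. Qed.

Lemma actVK w : cancel (act w^-1) (act w).
Proof. by move=> x; rewrite -actM mulVg act1. Qed.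

Lemma act_inj w : injective (act w).
Proof. exact: can_inj (actK w). Qed.

Lemma cgenK i : cgen i * cgen i = 1.
Proof. by rewrite -{1}cgenV mulVg. Qed.

(** The generators being involutions, formal inverses of letters are redundant. *)
Lemma affineA_ind (P : affineA n -> Prop) :
  P 1 -> (forall i w, P w -> P (cgen i * w)) -> forall w, P w.
Proof.
move=> P1 PM w; have [p ->] := pword_surj w.
elim: p => [|l p IHp] //.
have -> : pword (group_rel (coxeter_relator (@affineA_matrix n))) (l :: p) =
    pword _ [:: l] * pword _ p by rewrite -pwordM.
case: l => i; first exact: PM.
suff -> : pword (group_rel (coxeter_relator (@affineA_matrix n))) [:: inr i] = cgen i.
  exact: PM.
rewrite -[RHS]cgenV; apply: (@mulIg _ (cgen i)); rewrite mulVg.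
rewrite -[cgen i]/(pword _ [:: inl i]) -pwordM; apply/pwordP.
exact: (word_cong_rel [::] [::] (group_rel_cancel _ (inr i))).
Qed.

Lemma act_translate w k x : act w (translate k x) = translate k (act w x).
Proof.
elim/affineA_ind: w x => [|i w IHw] x; first by rewrite !act1.
by rewrite !actM !act_cgen /gact aswap_translate IHw.
Qed.

(** The permutation of residues, taken from a word so that bijectivity comes for
    free; it is read off the action in [act_fst]. *)
Definition sperm w : {perm 'I_n} :=
  \prod_(l <- generic_quotient.repr w) (let i := match l with inl i => i | inr i => i end in
                       tperm i (ordS i)).

Definition shift w a : int := (act w (a, 0%R)).2.

Lemma actE w x : act w x = (sperm w x.1, x.2 + shift w x.1)%R.
Proof.
rewrite [LHS]surjective_pairing; congr pair.
  rewrite /act /sperm; elim: (generic_quotient.repr w) x => [|l p IHp] x.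
    by rewrite big_nil perm1.
  by rewrite big_cons permM /= IHp aswap_fst.
have -> : x = translate x.2 (x.1, 0%R) by case: x => z k; rewrite /translate /= GRing.add0r.
by rewrite act_translate /= GRing.addrC GRing.add0r.
Qed.

Lemma act_fst w x : (act w x).1 = sperm w x.1.
Proof. by rewrite actE. Qed.

Lemma sperm_eq w (s : {perm 'I_n}) : (forall z k, (act w (z, k)).1 = s z) -> sperm w = s.
Proof. by move=> E; apply/permP => z; rewrite -(E z 0%R) act_fst. Qed.

Lemma spermM u v : sperm (u * v) = sperm u * sperm v.
Proof. by apply: sperm_eq => z k; rewrite actM !actE permM. Qed.

Lemma sperm1 : sperm 1 = 1.
Proof. by apply: sperm_eq => z k; rewrite act1 perm1. Qed.

Lemma shiftM u v a : shift (u * v) a = (shift u a + shift v (sperm u a))%R.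
Proof. by rewrite /shift actM [act u _]actE GRing.add0r actE. Qed.

Lemma shift1 a : shift 1 a = 0%R.
Proof. by rewrite /shift act1. Qed.

(** * Faithfulness of the action *)

(** The order of the integers encoded by the pairs. *)
Definition below x y : Prop := (x.2 < y.2)%R \/ x.2 = y.2 /\ (x.1 < y.1)%N.

Lemma below_trans x y z : below x y -> below y z -> below x z.
Proof. rewrite /below; lia. Qed.

Lemma below_irr x : ~ below x x.
Proof. rewrite /below; lia. Qed.

Lemma below_total x y : x <> y -> below x y \/ below y x.
Proof.
case: x y => [a k] [b l] xy; rewrite /below /=.
have: k <> l \/ (a : nat) <> b.
  case: (eqVneq k l) => [E|/eqP]; last by left.
  by right=> ab; apply: xy; congr pair => //; apply: val_inj.
lia.
Qed.

Definition base i : 'I_n * int := (i, 0%R).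
Definition next i : 'I_n * int := (ordS i, wrap i).
Definition ascent w i := below (act w (base i)) (act w (next i)).
Definition descent w i := below (act w (next i)) (act w (base i)).

Lemma gact_base i : gact i (base i) = next i.
Proof. by rewrite /gact aswapL GRing.add0r. Qed.

Lemma gact_next i : gact i (next i) = base i.
Proof. by rewrite -gact_base gactK. Qed.

Lemma ascent1 i : ascent 1 i.
Proof.
rewrite /ascent !act1 /base /next /below /wrap /= -[(i.+1 %% n)%N]/(nat_of_ord (ordS i)) ordSE.
by case: eqP => /=; lia.
Qed.

(** These are the elements of Coxeter length [k]: each step creates an inversion. *)
Inductive climb : nat -> affineA n -> Prop :=
| climb0 : climb 0 1
| climbS (k : nat) w i : climb k w -> ascent w i -> climb k.+1 (cgen i * w).

Lemma descentM w i : descent (cgen i * w) i <-> ascent w i.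
Proof. by rewrite /descent /ascent !actM !act_cgen gact_base gact_next. Qed.

Local Notation W_rel := (group_rel (coxeter_relator (@affineA_matrix n))).

Lemma pword_cgen i p : pword W_rel (inl i :: p) = cgen i * (pword W_rel p : affineA n).
Proof. exact: (pwordM W_rel [:: inl i] p). Qed.

Lemma cgen_comm i j : i != j -> j != ordS i -> i != ordS j ->
  cgen i * cgen j = cgen j * cgen i.
Proof.
move=> ij ji ij'.
have /pwordP : word_cong W_rel [:: inl i; inl j; inl i; inl j] [::].
  apply: (@word_cong_rel _ _ [::] [::] [:: inl i; inl j; inl i; inl j] [::]).
  apply: group_rel_relator; exists i, j.
  by rewrite /affineA_matrix (negPf ij) (negPf ji) (negPf ij').
rewrite !pword_cgen => E; apply: (mulIg (cgen i * cgen j)).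
rewrite -!mulgA (mulgA (cgen i) (cgen i)) cgenK mul1g cgenK -[RHS]E.
by rewrite -[pword _ [::]]/(1 : affineA n) mulg1.
Qed.

Lemma cgen_braid i : n != 2 ->
  cgen i * cgen (ordS i) * cgen i = cgen (ordS i) * cgen i * cgen (ordS i).
Proof.
move=> n2; set j := ordS i.
have /pwordP : word_cong W_rel [:: inl i; inl j; inl i; inl j; inl i; inl j] [::].
  apply: (@word_cong_rel _ _ [::] [::] [:: inl i; inl j; inl i; inl j; inl i; inl j] [::]).
  apply: group_rel_relator; exists i, j.
  by rewrite /affineA_matrix (negPf (ordS_neq i)) eqxx (negPf n2).
rewrite !pword_cgen -[pword _ [::]]/(1 : affineA n) mulg1 => E.
apply: (mulIg (cgen j * cgen i * cgen j)); rewrite -!mulgA E.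
by rewrite (mulgA (cgen j) (cgen j)) cgenK mul1g (mulgA (cgen i) (cgen i))
  cgenK mul1g cgenK.
Qed.

Lemma ascent_fix j w i : i != j -> j != ordS i -> i != ordS j ->
  (ascent (cgen j * w) i <-> ascent w i) /\ (descent (cgen j * w) i <-> descent w i).
Proof.
move=> ij ji ij'; rewrite /ascent /descent !actM !act_cgen.
rewrite (gact_fix (x := base i)) // (gact_fix (x := next i)) //=.
  by rewrite eq_sym.
by rewrite (inj_eq ordS_inj).
Qed.

(** For the generators at [a] and [ordS a] only three consecutive positions
    matter: [base a], [next a] and this one. *)
Definition next2 a := translate (wrap a) (next (ordS a)).

Lemma next_base a : next a = translate (wrap a) (base (ordS a)).
Proof. by rewrite /translate /= GRing.add0r. Qed.

Lemma below_translateE k x y : below (translate k x) (translate k y) <-> below x y.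
Proof. rewrite /below /=; lia. Qed.

Lemma ascent_ordS u a : ascent u (ordS a) <-> below (act u (next a)) (act u (next2 a)).
Proof.
rewrite /next2 (next_base a) !act_translate.
by split=> /below_translateE.
Qed.

Lemma descent_ordS u a : descent u (ordS a) <-> below (act u (next2 a)) (act u (next a)).
Proof.
rewrite /next2 (next_base a) !act_translate.
by split=> /below_translateE.
Qed.

Lemma gact_ordS_next a : gact (ordS a) (next a) = next2 a.
Proof. by rewrite next_base /gact aswap_translate -/(gact _ _) gact_base. Qed.

Lemma gact_ordS_next2 a : gact (ordS a) (next2 a) = next a.
Proof. by rewrite -gact_ordS_next gactK. Qed.

Lemma ordSS_neq a : n != 2 -> a != ordS (ordS a).
Proof.
move=> n2; apply/eqP => /(congr1 (@nat_of_ord n)); rewrite ordSE ordSE.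
by have := ltn_ord a; case: (a.+1 =P n) => [|_]; case: eqP => /=; lia.
Qed.

Lemma gact_ordS_base a : n != 2 -> gact (ordS a) (base a) = base a.
Proof. by move=> n2; rewrite gact_fix ?ordS_neq ?ordSS_neq. Qed.

Lemma gact_next2 a : n != 2 -> gact a (next2 a) = next2 a.
Proof. by move=> n2; rewrite gact_fix //= eq_sym ?ordS_neq ?ordSS_neq. Qed.

(** In rank two the third position is the first one, one period later. *)
Lemma below_next2 u a : n = 2 -> below (act u (base a)) (act u (next2 a)).
Proof.
move=> n2; suff -> : next2 a = translate 1 (base a).
  by rewrite act_translate /below /=; lia.
have aa : ordS (ordS a) = a.
  apply: ord_inj; rewrite ordSE ordSE.
  by move: (ltn_ord a); move: (nat_of_ord a) => m; rewrite n2; case: m => [|[|m]].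
rewrite /next2 /translate /= aa; congr pair; rewrite /wrap ordSE.
by move: (ltn_ord a); move: (nat_of_ord a) => m; rewrite n2; case: m => [|[|m]].
Qed.

(** This is the exchange property. For commuting generators the inversion at [i] is
    carried along the last climbing step; for neighbours the three consecutive
    values involved are sorted by the braid word, one generator at a time. *)
Lemma climb_exchange (k : nat) w i : climb k w -> descent w i ->
  exists2 l, k = l.+1 & climb l (cgen i * w).
Proof.
elim/ltn_ind: k w i => k IHk w i kw.
case: kw IHk => {k w} [|k v j kv vj] IHk wi.
  by case: (below_irr (below_trans wi (ascent1 i))).
exists k => //; have [ij|ij] := eqVneq i j.
  by rewrite ij mulgA cgenK mul1g.
have IH (l : nat) u a : (l <= k)%N -> climb l u -> descent u a ->
    exists2 l', l = l'.+1 & climb l' (cgen a * u).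
  by move=> lk; apply: IHk.
have braid a b u : ordS a = b \/ ordS b = a -> n != 2 ->
    cgen a * (cgen b * u) = cgen b * (cgen a * (cgen b * (cgen a * u))).
  move=> ab n2; rewrite !mulgA; congr (_ * u).
  have -> : cgen b * cgen a * cgen b = cgen a * cgen b * cgen a.
    by case: ab => <-; rewrite cgen_braid.
  by rewrite -(mulgA _ (cgen a)) cgenK mulg1.
have wj : descent (cgen j * v) j by apply/descentM.
have [n2|n2] := eqVneq n 2.
  (* Two generators: a descent at both would contradict periodicity. *)
  have jE : j = ordS i.
    apply: ord_inj; rewrite ordSE; have {}ij : i <> j :> nat by move=> /ord_inj/eqP; apply/negP.
    by have := ltn_ord i; have := ltn_ord j; case: eqP; lia.
  rewrite jE in wj wi; have /descent_ordS wj' := wj.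
  by case: (below_irr (below_trans (below_trans wj' wi) (below_next2 _ _ n2))).
have [jE|ji] := eqVneq j (ordS i).
  subst j; have v12 := (ascent_ordS v i).1 vj.
  move: wi; rewrite /descent !actM !act_cgen gact_ordS_next gact_ordS_base // => v20.
  have [l kE kl] := IH k v i (leqnn k) kv (below_trans v12 v20).
  have [l' lE kl'] : exists2 l', l = l'.+1 & climb l' (cgen (ordS i) * (cgen i * v)).
    apply: IH; rewrite ?kE //.
    by apply/descent_ordS; rewrite !actM !act_cgen gact_next gact_next2.
  rewrite kE lE (braid i (ordS i)) //; last by left.
  apply: climbS.
    apply: climbS => //.
    rewrite /ascent !actM !act_cgen gact_ordS_next gact_ordS_base //.
    by rewrite gact_base gact_next2.
  apply/ascent_ordS; rewrite !actM !act_cgen.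
  rewrite gact_next gact_next2 // gact_ordS_base // gact_ordS_next2 gact_base gact_next.
  exact: below_trans v12 v20.
have [iE|ij'] := eqVneq i (ordS j).
  subst i; move: wi => /descent_ordS; rewrite !actM !act_cgen gact_next gact_next2 // => v20.
  have [l kE kl] : exists2 l, k = l.+1 & climb l (cgen (ordS j) * v).
    apply: IH => //.
    by apply/descent_ordS; apply: below_trans v20 vj.
  have [l' lE kl'] : exists2 l', l = l'.+1 & climb l' (cgen j * (cgen (ordS j) * v)).
    apply: IH; rewrite ?kE //.
    by rewrite /descent !actM !act_cgen gact_ordS_next gact_ordS_base.
  rewrite kE lE (braid (ordS j) j) //; last by right.
  apply: climbS.
    apply: climbS => //; apply/ascent_ordS; rewrite !actM !act_cgen.
    by rewrite gact_next gact_next2 // gact_ordS_base // gact_ordS_next2.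
  rewrite /ascent !actM !act_cgen gact_ordS_next gact_ordS_base //.
  rewrite gact_next2 // gact_ordS_next2 gact_base gact_ordS_next.
  exact: below_trans v20 vj.
have [_ vi] := ascent_fix v ij ji ij'.
have [l kE kl] := IH k v i (leqnn k) kv (vi.1 wi).
rewrite mulgA cgen_comm // -mulgA kE; apply: climbS => //.
have nji : j != i by rewrite eq_sym.
by case: (ascent_fix v nji ij' ji) => vj' _; apply/vj'.
Qed.

Lemma climb_exists w : exists k : nat, climb k w.
Proof.
elim/affineA_ind: w => [|i w [k kw]]; first by exists 0%N; exact: climb0.
have [|wi|wi] := below_total (x := act w (base i)) (y := act w (next i)).
- by move=> /act_inj[iE _]; have := ordS_neq i; rewrite -iE eqxx.
- by exists k.+1; apply: climbS.
- by have [l _ kl] := climb_exchange kw wi; exists l.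
Qed.

(** An element acting trivially has no descent, so that no climbing path can
    end there unless it is empty. *)
Lemma act_faithful u v : act u =1 act v -> u = v.
Proof.
suff triv w : act w =1 id -> w = 1.
  move=> uv; apply: (mulIg v^-1); rewrite mulgV; apply: triv => x.
  by rewrite actM uv actK.
move=> w1; have [k kw] := climb_exists w.
case: kw w1 => // l v' i _ v'i w1.
have /descentM := v'i; rewrite /descent !w1 => wi.
by case: (below_irr (below_trans wi _)); have := ascent1 i; rewrite /ascent !act1.
Qed.

(** * Reflections and reflection length *)

(** As all reflections are conjugate to generators, this makes them all swaps. *)
Lemma act_conj t w a b d : a != b -> act t =1 aswap a b d ->
  act (t ^ w) =1 aswap (sperm w a) (sperm w b) (d + shift w b - shift w a).
Proof.
move=> ab tE x; rewrite conjgE !actM -{2}(actVK w x); move: (act w^-1 x) => [z k].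
rewrite tE /aswap /=; have [->|za] := eqVneq z a.
  by rewrite !actE /= eqxx; congr pair; lia.
have [->|zb] := eqVneq z b.
  by rewrite !actE /= (inj_eq perm_inj) eq_sym (negPf ab) eqxx; congr pair; lia.
by rewrite !actE /= !(inj_eq perm_inj) (negPf za) (negPf zb).
Qed.

Lemma reflection_aswap t : reflection t ->
  exists a b d, a != b /\ act t =1 aswap a b d.
Proof.
case=> i [w ->]; do 3![eexists]; split; last first.
  by apply: (act_conj w (ordS_neq i)) => x; rewrite act_cgen.
by rewrite (inj_eq perm_inj) ordS_neq.
Qed.

Lemma reflectionJ t w : reflection t -> reflection (t ^ w).
Proof. by case=> i [v ->]; exists i, (v * w); rewrite conjgM. Qed.

Lemma reflectionK t : reflection t -> t * t = 1.
Proof. by case=> i [w ->]; rewrite -conjMg cgenK conj1g. Qed.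

Lemma reflectionV t : reflection t -> t^-1 = t.
Proof. by move/reflectionK=> tt; apply: (mulIg t); rewrite mulVg tt. Qed.

Lemma reflection_conj r t : reflection r -> reflection t -> reflection (r * t * r).
Proof. by move=> rr rt; rewrite -{1}(reflectionV rr) -mulgA -conjgE; apply: reflectionJ. Qed.

Lemma reflection_cgen i : reflection (cgen i).
Proof. by exists i, 1; rewrite conjg1. Qed.

Lemma sperm_aswap t a b d : act t =1 aswap a b d -> sperm t = tperm a b.
Proof. by move=> tE; apply: sperm_eq => z k; rewrite tE aswap_fst. Qed.

Lemma odd_sperm_reflection t : reflection t -> odd_perm (sperm t).
Proof.
by case/reflection_aswap=> [a [b [d [ab tE]]]]; rewrite (sperm_aswap tE) odd_tperm.
Qed.

Definition reflections (ts : seq (affineA n)) : Prop := forall t, t \in ts -> reflection t.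

Definition wprod (ts : seq (affineA n)) : affineA n := \prod_(t <- ts) t.

Lemma reflections_cat ts us :
  reflections (ts ++ us) <-> reflections ts /\ reflections us.
Proof.
split=> [h|[h h'] t]; last by rewrite mem_cat => /orP[/h|/h'].
by split=> t tts; apply: h; rewrite mem_cat tts ?orbT.
Qed.

Lemma reflections_cons t ts :
  reflections (t :: ts) <-> reflection t /\ reflections ts.
Proof.
rewrite -cat1s reflections_cat; split=> -[h h']; split=> //; first exact/h/mem_head.
by move=> t'; rewrite inE => /eqP->.
Qed.

Lemma wprod_cat ts us : wprod (ts ++ us) = wprod ts * wprod us.
Proof. exact: big_cat. Qed.

Lemma wprod_cons t ts : wprod (t :: ts) = t * wprod ts.
Proof. exact: big_cons. Qed.

Lemma wprod_nil : wprod [::] = 1.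
Proof. exact: big_nil. Qed.

Local Notation lR := (@reflection_length n).

Lemma lR_le ts : reflections ts -> (lR (wprod ts) <= size ts)%N.
Proof.
move=> tsR; rewrite /reflection_length; case: ex_minnP => m _; apply.
by apply/asboolP; exists ts.
Qed.

Lemma lR_ex w : exists ts, [/\ reflections ts, w = wprod ts & size ts = lR w].
Proof.
rewrite /reflection_length; case: ex_minnP => m /asboolP[ts sz [tsR ->]] _.
by exists ts.
Qed.

Lemma lRM u v : lR (u * v) <= lR u + lR v.
Proof.
have [us [usR -> <-]] := lR_ex u; have [vs [vsR -> <-]] := lR_ex v.
by rewrite -wprod_cat -size_cat lR_le //; apply/reflections_cat.
Qed.

Lemma wprodJ ts w : wprod [seq t ^ w | t <- ts] = wprod ts ^ w.
Proof.
elim: ts => [|t ts IHts]; first by rewrite /= wprod_nil conj1g.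
by rewrite /= !wprod_cons IHts conjMg.
Qed.

Lemma lRJ w u : lR (w ^ u) = lR w.
Proof.
suff le v (g : affineA n) : lR (v ^ g) <= lR v.
  by apply/eqP; rewrite eqn_leq le -{1}(conjgK u w) le.
have [ts [tsR -> <-]] := lR_ex v.
rewrite -wprodJ -(size_map (fun t => t ^ g)) lR_le // => t /mapP[t' t'ts ->].
exact/reflectionJ/tsR.
Qed.

Lemma odd_sperm_wprod ts : reflections ts -> odd_perm (sperm (wprod ts)) = odd (size ts).
Proof.
elim: ts => [|t ts IHts]; first by rewrite wprod_nil sperm1 odd_perm1.
case/reflections_cons=> tR /IHts; rewrite wprod_cons spermM odd_permM => ->.
by rewrite odd_sperm_reflection.
Qed.

Lemma odd_lR w : odd (lR w) = odd_perm (sperm w).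
Proof. by have [ts [tsR wE <-]] := lR_ex w; rewrite -odd_sperm_wprod // -wE. Qed.

Lemma lR1 : lR 1 = 0%N.
Proof. by apply/eqP; rewrite -leqn0 -wprod_nil lR_le. Qed.

Lemma lR_eq0 w : lR w = 0%N -> w = 1.
Proof. by have [ts [_ wE <-]] := lR_ex w; move/size0nil=> tsE; rewrite wE tsE wprod_nil. Qed.

Lemma lR_reflection t : reflection t -> lR t = 1%N.
Proof.
move=> tR; have : odd (lR t) by rewrite odd_lR odd_sperm_reflection.
suff : (lR t <= 1)%N by case: (lR t) => [|[]].
have -> : t = wprod [:: t] by rewrite wprod_cons wprod_nil mulg1.
by apply: lR_le; apply/reflections_cons.
Qed.

Lemma lR_pair r t : reflection r -> reflection t -> r <> t -> lR (r * t) = 2.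
Proof.
move=> rR tR rt; have : ~~ odd (lR (r * t)).
  by rewrite odd_lR spermM odd_permM !odd_sperm_reflection.
have : lR (r * t) <= 2 by rewrite (leq_trans (lRM _ _)) // !lR_reflection.
case E : (lR (r * t)) => [|[|[|]]] // _ _; case: rt.
by apply: (mulIg t); rewrite (reflectionK tR); apply: lR_eq0.
Qed.

(** * Reduced words of divisors *)

Definition reduced_word c ts : Prop :=
  [/\ reflections ts, divides (wprod ts) c & lR (wprod ts) = size ts].

(** Reflection length is invariant under conjugation, so that the letters before
    [us] can be moved behind it. *)
Lemma reduced_infix c as_ bs us :
  reduced_word c (as_ ++ us ++ bs) -> reduced_word c us.
Proof.
case=> /reflections_cat[aR /reflections_cat[uR bR]] [v cE lc].
rewrite !wprod_cat in cE lc *; set A := wprod as_ in cE lc *.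
set U := wprod us in cE lc *; set B := wprod bs in cE lc *.
rewrite !size_cat => lE; have lA := lR_le aR; have lU := lR_le uR; have lB := lR_le bR.
rewrite -/A -/U -/B in lA lU lB.
have lUE : lR U = size us.
  by have := lRM A (U * B); have := lRM U B; lia.
pose P : affineA n := A ^ U * B * v.
have cP : c = U * P by rewrite cE /P conjgE -!mulgA mulKVg.
split=> //; exists P => //; have lP : lR P <= lR A + lR B + lR v.
  by apply: leq_trans (lRM _ _) _; rewrite leq_add2r -(lRJ A U) lRM.
have lc' : lR c <= lR U + lR P by rewrite {1}cP lRM.
by rewrite -/U; move: lc' lP; move: (lR P) => p; rewrite lc lE; lia.
Qed.

Lemma reduced_cons c t ts : reduced_word c (t :: ts) -> reduced_word c ts.
Proof. by move=> h; apply: (@reduced_infix c [:: t] [::] ts); rewrite cats0. Qed.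

Lemma reduced_letter c t ts : reduced_word c ts -> t \in ts -> reflection t /\ divides t c.
Proof.
move=> red tts; case/path.splitPr: tts red => a b red.
have [/reflections_cons[tR _]] := @reduced_infix c a b [:: t] red.
by rewrite wprod_cons wprod_nil mulg1; split.
Qed.

Lemma reduced_exists c w : divides w c -> exists2 ts, reduced_word c ts & w = wprod ts.
Proof. by move=> wc; have [ts [tsR wE tsl]] := lR_ex w; exists ts => //; split; rewrite -?wE. Qed.

(** * Divisors acting as translations *)

Lemma card_porbits1 (T : finType) : #|porbits (1 : {perm T})| = #|T|.
Proof.
apply: card_imset => x y E; have := porbit_id 1 x; rewrite E.
by case/porbitP=> i ->; rewrite expg1n perm1.
Qed.

Definition cycles w : nat := #|porbits (sperm w)|.

Lemma cycles1 : cycles 1 = n.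
Proof. by rewrite /cycles sperm1 card_porbits1 card_ord. Qed.

Lemma cycles_reflectionM t w a b : a != b -> sperm t = tperm a b ->
  cycles (t * w) + (a \notin porbit (sperm w) b).*2 =
  (cycles w).+1.
Proof. by move=> ab tE; rewrite /cycles spermM tE porbits_mul_tperm ab addn1. Qed.

Lemma cycles_word ts : reflections ts ->
  n <= cycles (wprod ts) + size ts.
Proof.
elim: ts => [|t ts IHts].
  by move=> _; rewrite wprod_nil addn0 cycles1.
case/reflections_cons=> /reflection_aswap[a [b [d [ab tE]]]] /IHts; rewrite wprod_cons.
have := cycles_reflectionM (wprod ts) ab (sperm_aswap tE).
by case: (a \notin _) => /=; lia.
Qed.

Lemma stable_porbit (s : {perm 'I_n}) (X : {set 'I_n}) a b :
  (forall z, (s z \in X) = (z \in X)) -> a \in porbit s b -> (a \in X) = (b \in X).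
Proof.
move=> sX /porbitP[i ->]; elim: i => [|i IHi]; first by rewrite perm1.
by rewrite expgSr permM sX.
Qed.

(** Multiplying by a transposition changes the number of orbits by one. A word of
    [n - k] reflections whose product has [k] orbits therefore merges two orbits
    at each step, hence preserves every union of orbits of its product. *)
Lemma tight_word_stable (X : {set 'I_n}) ts : reflections ts ->
  cycles (wprod ts) + size ts = n ->
  (forall z, (sperm (wprod ts) z \in X) = (z \in X)) ->
  forall t, t \in ts -> forall z, (sperm t z \in X) = (z \in X).
Proof.
elim: ts => // t ts IHts /reflections_cons[tR tsR]; rewrite wprod_cons.
move: (wprod ts) (cycles_word tsR) IHts => w nw IHts tight wX.
have [a [b [d [ab tE]]]] := reflection_aswap tR.
have tab := sperm_aswap tE.
have E1 := cycles_reflectionM w ab tab.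
have := cycles_reflectionM (t * w) ab tab.
rewrite mulgA reflectionK // mul1g => E2.
move: tight => /= tight.
have aw : a \in porbit (sperm (t * w)) b.
  by move: E1 E2; case: (a \in porbit (sperm (t * w)) b); case: (a \notin _) => //=; lia.
have abX := stable_porbit wX aw.
have tX z : (sperm t z \in X) = (z \in X) by rewrite tab; case: tpermP => // ->.
move=> t'; rewrite inE => /orP[/eqP->//|]; apply: IHts => //.
  by move: E1 E2; rewrite aw; case: (a \notin _) => /=; lia.
by move=> z; rewrite -[z](permKV (sperm t)) -permM -spermM wX tX.
Qed.

(** The total displacement in periods; it is additive on products of elements
    preserving [X]. *)
Definition winding (X : {set 'I_n}) w : int := (\sum_(z in X) shift w z)%R.

Lemma sum_delta (X : {set 'I_n}) a d : (\sum_(z in X) d *+ (z == a) = d *+ (a \in X))%R.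
Proof.
rewrite big_mkcond (bigD1 a) //= big1 => [|z /negPf->]; last by case: ifP.
by rewrite GRing.addr0 eqxx; case: ifP.
Qed.

Lemma winding_swap (X : {set 'I_n}) w a b d :
  (forall z, shift w z = d *+ (z == a) - d *+ (z == b))%R ->
  winding X w = (d *+ (a \in X) - d *+ (b \in X))%R.
Proof.
move=> wE; rewrite /winding (eq_bigr _ (fun z _ => wE z)) big_split /=.
by rewrite GRing.sumrN !sum_delta.
Qed.

Lemma shift_aswap t a b d z : a != b -> act t =1 aswap a b d ->
  shift t z = (d *+ (z == a) - d *+ (z == b))%R.
Proof.
move=> ab tE; rewrite /shift tE /aswap /=; have [->|za] := eqVneq z a.
  by rewrite (negPf ab) GRing.mulr0n GRing.mulr1n /=; lia.
by case: (z == b); rewrite ?GRing.mulr0n ?GRing.mulr1n /=; lia.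
Qed.

Lemma windingM (X : {set 'I_n}) u v : (forall z, (sperm u z \in X) = (z \in X)) ->
  winding X (u * v) = (winding X u + winding X v)%R.
Proof.
move=> uX; rewrite /winding (eq_bigr _ (fun z _ => shiftM u v z)) big_split /=.
congr (_ + _)%R; rewrite [RHS](reindex_inj (@perm_inj _ (sperm u))) /=.
by apply: eq_bigl => z; rewrite uX.
Qed.

Lemma winding_word (X : {set 'I_n}) ts : reflections ts ->
  (forall t, t \in ts -> forall z, (sperm t z \in X) = (z \in X)) ->
  winding X (wprod ts) = 0%R.
Proof.
elim: ts => [|t ts IHts].
  by move=> _ _; rewrite wprod_nil /winding big1 // => z _; rewrite shift1.
case/reflections_cons=> /reflection_aswap[a [b [d [ab tE]]]] tsR tsX.
have tX := tsX _ (mem_head _ _).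
rewrite wprod_cons windingM // IHts // => [|t' t'ts].
  rewrite (winding_swap _ (fun z => shift_aswap z ab tE)) -(tX a) (sperm_aswap tE).
  by rewrite tpermL GRing.subrr GRing.addr0.
by apply: tsX; rewrite inE t'ts orbT.
Qed.

(** Any moved residue can serve as the first one of the swap: a reflection is
    determined by the image of a residue that it moves. *)
Lemma reflection_moved t a : reflection t -> sperm t a != a ->
  a != sperm t a /\ act t =1 aswap a (sperm t a) (shift t a).
Proof.
move=> /reflection_aswap[b [c [d [bc tE]]]] ta; split; first by rewrite eq_sym.
move: ta; rewrite (sperm_aswap tE) /shift tE => + x.
case: tpermP => [->|->|]; last by rewrite eqxx.
- by rewrite tE aswapL /= GRing.add0r.
- by rewrite tE aswapR //= GRing.sub0r aswapC.
Qed.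

Lemma reflection_fixed t a k : reflection t -> sperm t a = a -> act t (a, k) = (a, k).
Proof.
move=> /reflection_aswap[b [c [d [bc tE]]]]; rewrite (sperm_aswap tE) tE.
case: tpermP => [->|->|]; last by move=> /eqP ab /eqP ac _; apply: aswap_fix.
- by move/eqP; rewrite eq_sym (negPf bc).
- by move/eqP; rewrite (negPf bc).
Qed.

Definition cprod (q : seq 'I_n) : affineA n := \prod_(i <- q) cgen i.

Lemma cprodE q : cprod q = wprod [seq cgen i | i <- q].
Proof. by rewrite /cprod /wprod big_map. Qed.

Lemma sperm_cgen i : sperm (cgen i) = tperm i (ordS i).
Proof. exact/sperm_aswap/act_cgen. Qed.

(** The product of two such reflections translates one residue by one period and
    the other one backwards. *)
Definition adjacent_parallel r t : Prop :=
  exists a b d e, [/\ a != b, act r =1 aswap a b d,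
    act t =1 aswap a b (d + e) & e = 1%R \/ e = (-1)%R].

Lemma adjacent_parallelJ r t g :
  adjacent_parallel r t -> adjacent_parallel (r ^ g) (t ^ g).
Proof.
move=> [a [b [d [e [ab rE tE eE]]]]].
exists (sperm g a), (sperm g b), (d + shift g b - shift g a)%R, e; split => //.
- by rewrite (inj_eq perm_inj).
- exact: act_conj.
- by move=> x; rewrite (act_conj g ab tE); congr (aswap _ _ _ x); lia.
Qed.

(* The residue at the end of a period: cutting there turns the cycle into a line. *)
Section CutCycle.
Variable last : 'I_n.
Hypothesis lastE : last.+1 = n.

Lemma ordS_not_last i : i != last -> ordS i = i.+1 :> nat.
Proof.
move=> il; rewrite ordSE; case: eqP => // iE.
by case/eqP: il; apply: ord_inj; lia.
Qed.

(** The generators other than the last one are the edges of a line, so that each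
    letter of the word merges two cycles, whatever the order of the letters. *)
Lemma cycles_cprod q : uniq q -> last \notin q ->
  cycles (cprod q) + size q = n.
Proof.
elim: q => [|i q IHq] /=.
  by move=> _ _; rewrite /cprod big_nil addn0 cycles1.
case/andP=> iq uq; rewrite inE negb_or => /andP[il lq].
have := IHq uq lq; rewrite {2}/cprod big_cons -/(cprod q).
have := cycles_reflectionM (cprod q) (ordS_neq i) (sperm_cgen i).
suff -> : i \notin porbit (sperm (cprod q)) (ordS i) by rewrite /=; lia.
(* The residues beyond i are only linked to the others by the generators i and last. *)
pose X := [set z : 'I_n | i < z].
suff qX z : (sperm (cprod q) z \in X) = (z \in X).
  apply/negP => /(stable_porbit qX); rewrite !inE ltnn.
  by rewrite ordS_not_last // 1?eq_sym // ltnSn.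
elim: q iq lq z {IHq uq} => [|j q IHq].
  by move=> _ _ z; rewrite /cprod big_nil sperm1 perm1.
rewrite !inE !negb_or => /andP[ij iq] /andP[lj lq] z.
rewrite /cprod big_cons -/(cprod q) spermM permM IHq // sperm_cgen.
have ij' : i <> j :> nat by move=> /ord_inj/eqP; apply/negP.
by case: tpermP => // ->; rewrite !inE ordS_not_last 1?eq_sym //; lia.
Qed.

Lemma cprod_shift q z : last \notin q -> shift (cprod q) z = 0%R.
Proof.
elim: q z => [|i q IHq] z; first by rewrite /cprod big_nil shift1.
rewrite inE negb_or /cprod big_cons -/(cprod q) => /andP[il lq].
rewrite shiftM IHq // (shift_aswap z (ordS_neq i) (act_cgen i)) /wrap.
rewrite (_ : i.+1 == n = false) ?GRing.mul0rn //.
by apply/eqP => iE; case/eqP: il; apply: ord_inj; lia.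
Qed.

(** A divisor acting trivially on residues has a complement with the two cycles
    of the Coxeter element, hence of length at least [n - 2]. In the extremal case
    the complement does not move anything across the two cycles, so that the
    winding of the Coxeter element along one of its cycles, which is one, is
    carried by the divisor. *)
Lemma translation_rotated q ts : uniq q -> last \notin q -> (size q).+1 = n ->
  reduced_word (cgen last * cprod q) ts -> sperm (wprod ts) = 1 ->
  ts = [::] \/ exists r t, ts = [:: r; t] /\ adjacent_parallel r t.
Proof.
move=> uq lq szq; set c := cgen last * cprod q => -[tsR [v cE lc] tsl] ts1.
have cq : cycles (cprod q) = 1%N by have := cycles_cprod uq lq; lia.
have lS := ordS_neq last.
have C1 := cycles_reflectionM (cprod q) lS (sperm_cgen last).
have C2 := cycles_reflectionM c lS (sperm_cgen last).
rewrite -/c cq in C1; rewrite {1}/c mulgA cgenK mul1g cq in C2.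
have ln : reflection_length c <= n.
  have -> : c = wprod [seq cgen i | i <- last :: q] by rewrite wprod_cons -cprodE.
  have qR : reflections [seq cgen i | i <- last :: q].
    by move=> t /mapP[i _ ->]; apply: reflection_cgen.
  by apply: leq_trans (lR_le qR) _; rewrite size_map /= szq.
have vc : sperm v = sperm c by rewrite cE spermM ts1 mul1g.
have [vs [vsR vE vsl]] := lR_ex v.
have nv : n <= cycles c + size vs.
  by have := cycles_word vsR; rewrite -vE /cycles vc.
have c2 : cycles c <= 2 by move: C1; case: (last \notin _) => /=; lia.
have := odd_sperm_wprod tsR; rewrite ts1 odd_perm1.
have : size ts <= 2 by lia.
case: ts tsR cE lc tsl ts1 => [|r [|t [|]]] //; first by left.
move=> /reflections_cons[rR /reflections_cons[tR _]] cE lc tsl ts1 _ _; right.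
exists r, t; split=> //.
have cyc2 : cycles c = 2%N by rewrite /= in tsl; lia.
have lX : ordS last \notin porbit (sperm c) last.
  by rewrite porbit_sym; move: C2; case: (last \notin _) => //=; lia.
set X := porbit (sperm c) last in lX.
have cX z : (sperm c z \in X) = (z \in X).
  by have := porbit_perm (sperm c) 1 z; rewrite expg1 /X -!eq_porbit_mem => ->.
have windv : winding X v = 0%R.
  rewrite vE; apply: winding_word => //; apply: tight_word_stable => //.
    by rewrite -vE /cycles vc -/(cycles c) /= in tsl *; lia.
  by move=> z; rewrite -vE vc cX.
have windc : winding X c = 1%R.
  rewrite (@winding_swap X c last (ordS last) 1%R) => [|z].
    by rewrite porbit_id (negPf lX).
  rewrite shiftM cprod_shift // GRing.addr0 (shift_aswap z lS (act_cgen last)).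
  by rewrite /wrap lastE eqxx.
rewrite cE windingM ?windv ?GRing.addr0 in windc; last by move=> z; rewrite ts1 perm1.
have rE0 := reflection_aswap rR.
have [a [b [d [ab rE]]]] := rE0.
have spt : sperm t = tperm a b.
  apply: (mulgI (sperm r)); rewrite -spermM -[r * t]mulg1 -wprod_nil.
  by rewrite -mulgA -!wprod_cons ts1 (sperm_aswap rE) tperm2.
have ta : sperm t a != a by rewrite spt tpermL eq_sym.
have [_] := reflection_moved tR ta.
rewrite spt tpermL => tE; move: (shift t a) tE => d' tE.
exists a, b, d, (d' - d)%R; split => //.
  by move=> x; rewrite tE; congr (aswap _ _ _ x); clear; lia.
move: windc; rewrite (@winding_swap X _ a b (d - d')%R) => [|z].
  by clear; case: (a \in X); case: (b \in X); rewrite ?GRing.mulr1n ?GRing.mulr0n; lia.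
rewrite wprod_cons wprod_cons wprod_nil mulg1 shiftM.
rewrite (shift_aswap _ ab rE) (shift_aswap _ ab tE) (sperm_aswap rE).
have [->|za] := eqVneq z a.
  by rewrite tpermL eqxx (negPf ab) eq_sym (negPf ab) ?GRing.mulr1n ?GRing.mulr0n; clear; lia.
have [->|zb] := eqVneq z b.
  by rewrite tpermR eqxx (negPf ab) ?GRing.mulr1n ?GRing.mulr0n; lia.
have tz : tperm a b z = z by rewrite tpermD // eq_sym.
by rewrite tz (negPf za) (negPf zb) ?GRing.mulr1n ?GRing.mulr0n; clear; lia.
Qed.

End CutCycle.

Lemma reduced_wordJ c ts g :
  reduced_word c ts -> reduced_word (c ^ g) [seq t ^ g | t <- ts].
Proof.
case=> tsR [v cE lc] ltsE; rewrite /reduced_word wprodJ size_map lRJ; split=> //.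
  by move=> t /mapP[t' /tsR t'R ->]; apply: reflectionJ.
by exists (v ^ g); rewrite ?lRJ // cE conjMg.
Qed.

(** A conjugation reduces to a Coxeter element starting with the last generator,
    so that all the winding comes from its first letter. *)
Lemma translation_divisor c ts : coxeter_element c -> reduced_word c ts ->
  sperm (wprod ts) = 1 ->
  ts = [::] \/ exists r t, ts = [:: r; t] /\ adjacent_parallel r t.
Proof.
case=> p pE cE tsc ts1.
have n_gt0 : n.-1 < n by lia.
pose last := Ordinal n_gt0; have lastE : last.+1 = n by rewrite /=; lia.
have up : uniq p by rewrite (perm_uniq pE) enum_uniq.
have szp : size p = n by rewrite (perm_size pE) size_enum_ord.
have /path.splitPr pS : last \in p by rewrite (perm_mem pE) mem_enum.
case: pS up szp cE => p1 p2; rewrite cat_uniq /= size_cat /=.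
move=> /and3P[u1 /norP[l1 d12] /andP[l2 u2]] szp cE.
(* Conjugation by the letters before last rotates the word of c. *)
pose g := cprod p1; pose q := p2 ++ p1.
have cgE : c ^ g = cgen last * cprod q.
  rewrite cE big_cat big_cons /= -!/(cprod _) conjgE -/g.
  by rewrite /q /cprod big_cat /= -!/(cprod _) -!mulgA mulKg.
have uq : uniq q by rewrite uniq_catC cat_uniq u1 u2 d12.
have lq : last \notin q by rewrite mem_cat negb_or l2 l1.
have szq : (size q).+1 = n by rewrite size_cat addnC -addnS szp.
have := reduced_wordJ g tsc; rewrite cgE => tsg.
have [||//] := translation_rotated lastE uq lq szq tsg.
- by rewrite wprodJ conjgE !spermM ts1 mul1g -spermM mulVg sperm1.
- by case: ts {tsc ts1 tsg} => //; left.
case=> r [t [tsE rt]]; right; exists (r ^ g^-1), (t ^ g^-1).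
split; last exact: adjacent_parallelJ.
by rewrite -[ts](mapK (conjgK g)) tsE.
Qed.

(** * Hurwitz moves *)

(** Unlike in [hurwitz_rel], the letters are elements of the group, so that no
    proof of divisibility has to be carried along with them. *)
Inductive hurwitz_move c : seq (affineA n) -> seq (affineA n) -> Prop :=
| HurwitzMove r t : reflection r -> reflection t -> r <> t -> divides (r * t) c ->
    hurwitz_move c [:: r; t] [:: r * t * r; r].

Local Notation heq c := (word_cong (@hurwitz_move c)).

Lemma heq_cons c t ts us : heq c ts us -> heq c (t :: ts) (t :: us).
Proof. by move=> h; apply: (@word_cong_cat _ _ [:: t] [:: t]) => //; apply: word_cong_refl. Qed.

Lemma heq_invariant c ts us : heq c ts us ->
  [/\ wprod ts = wprod us, size ts = size us & reflections ts <-> reflections us].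
Proof.
elim=> {ts us} [a b _ _ [r t rR tR _ _]|ts|ts us _ [-> -> h]|ts us vs _ [-> -> h] _ [-> -> h']] //.
- split.
  + rewrite !wprod_cat !wprod_cons wprod_nil !mulg1; congr (_ * (_ * _)).
    by rewrite -!mulgA (reflectionK rR) mulg1.
  + by rewrite !size_cat.
  + have rtr := reflection_conj rR tR.
    by split=> /reflections_cat[aR /reflections_cat[_ bR]];
       apply/reflections_cat; split=> //; apply/reflections_cat; split=> //;
       do ?[apply/reflections_cons; split=> //].
- by split=> //; split=> /h.
- by split=> //; rewrite h.
Qed.

Lemma heq_reduced c ts us : heq c ts us -> reduced_word c ts -> reduced_word c us.
Proof. by case/heq_invariant => E1 E2 E3 [/E3 R]; rewrite E1 E2; split. Qed.

Lemma reduced_reflection c t ts : reduced_word c (t :: ts) -> reflection t.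
Proof. by case=> /reflections_cons[]. Qed.

Lemma reduced_neq c r t ts : reduced_word c (r :: t :: ts) -> r <> t.
Proof.
move=> /(@reduced_infix c [::] ts [:: r; t])[/reflections_cons[rR _] _] + rt.
by rewrite -rt !wprod_cons wprod_nil mulg1 reflectionK // lR1.
Qed.

Lemma heq_swap c r t ts : reduced_word c (r :: t :: ts) ->
  heq c (r :: t :: ts) (r * t * r :: r :: ts).
Proof.
move=> red; have rt := reduced_neq red.
have [] := @reduced_infix c [::] ts [:: r; t] red.
rewrite !wprod_cons wprod_nil mulg1 => /reflections_cons[rR /reflections_cons[tR _]] rtc _.
exact: (word_cong_rel [::] ts (HurwitzMove rR tR rt rtc)).
Qed.

Lemma heq_swapV c r t ts : reduced_word c (r :: t :: ts) ->
  heq c (r :: t :: ts) (t :: t * r * t :: ts).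
Proof.
move=> red; have tR := reduced_reflection (reduced_cons red).
have rR := reduced_reflection red.
have E : t * (t * r * t) * t = r by rewrite !mulgA reflectionK // mul1g -mulgA reflectionK // mulg1.
have red' : reduced_word c (t :: t * r * t :: ts).
  have E' : wprod (t :: t * r * t :: ts) = wprod (r :: t :: ts).
    by rewrite !wprod_cons !mulgA reflectionK // mul1g.
  case: red => /reflections_cons[_ /reflections_cons[_ tsR]] rtc l.
  rewrite /reduced_word E'; split=> //.
  do 2![apply/reflections_cons; split=> //]; exact: reflection_conj.
by apply: word_cong_sym; have := heq_swap red'; rewrite E.
Qed.

(** In an infinite dihedral group, a Hurwitz move on two consecutive reflections
    slides the pair by one step; every reflection of the group can so be brought
    to the front. *)
Lemma adjacent_slide c r t a b d e d' (s : affineA n) ts : a != b -> act r =1 aswap a b d ->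
  act t =1 aswap a b (d + e) -> e = 1%R \/ e = (-1)%R ->
  reduced_word c (r :: t :: ts) -> act s =1 aswap a b d' ->
  exists y : affineA n, heq c (r :: t :: ts) (s :: y :: ts).
Proof.
move=> ab rE tE eE red sE.
(* The induction is on the distance to slide, in either direction. *)
have [k kE] : exists k : nat, (d' = d + e *+ k \/ d' = d - e *+ k)%R.
  exists `|d' - d|%N; case: eE => ->; lia.
elim: k r t d rE tE red kE => [|k IHk] r t d rE tE red kE.
  have -> : s = r; last by exists t; apply: word_cong_refl.
  apply: act_faithful => z; rewrite sE rE; congr (aswap _ _ _ z).
  by case: kE => ->; rewrite GRing.mulr0n; lia.
have red1 := heq_reduced (heq_swap red) red.
have red2 := heq_reduced (heq_swapV red) red.
have conjE (u v : affineA n) d1 d2 : act u =1 aswap a b d1 -> act v =1 aswap a b d2 ->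
    act (u * v * u) =1 aswap a b (d1 + d1 - d2)%R.
  move=> uE vE [z l]; rewrite !actM uE vE uE.
  have [->|za] := eqVneq z a.
    by rewrite aswapL aswapR // !aswapL; congr pair; lia.
  have [->|zb] := eqVneq z b; last by rewrite !aswap_fix.
  by rewrite aswapR // aswapL !aswapR //; congr pair; lia.
case: kE => kE.
  have tE' : act (t * r * t) =1 aswap a b (d + e + e)%R.
    by move=> z; rewrite (conjE _ _ _ _ tE rE); congr (aswap _ _ _ z); lia.
  have kE' : (d' = d + e + e *+ k \/ d' = d + e - e *+ k)%R.
    by left; rewrite kE GRing.mulrS GRing.addrA.
  have [y yE] := IHk t (t * r * t) _ tE tE' red2 kE'.
  by exists y; apply: word_cong_trans (heq_swapV red) yE.
have rE' : act (r * t * r) =1 aswap a b (d - e)%R.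
  by move=> z; rewrite (conjE _ _ _ _ rE tE); congr (aswap _ _ _ z); lia.
have tE' : act r =1 aswap a b (d - e + e)%R.
  by move=> z; rewrite rE; congr (aswap _ _ _ z); lia.
have kE' : (d' = d - e + e *+ k \/ d' = d - e - e *+ k)%R.
  by right; rewrite kE GRing.mulrS GRing.opprD GRing.addrA.
have [y yE] := IHk (r * t * r) r _ rE' tE' red1 kE'.
by exists y; apply: word_cong_trans (heq_swap red) yE.
Qed.

(** * Gathering the letters that move a residue *)

Definition fixes (m : 'I_n) t : bool := sperm t m == m.

(** Two letters swapping [m] with the same residue cannot be merged, as their
    product translates [m]; hence the last case. *)
Inductive gathered (m : 'I_n) : seq (affineA n) -> Prop :=
| Gathered0 ts : all (fixes m) ts -> gathered m ts
| Gathered1 t ts : ~~ fixes m t -> all (fixes m) ts -> gathered m (t :: ts)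
| Gathered2 r t ts : ~~ fixes m r -> sperm r = sperm t -> all (fixes m) ts ->
    gathered m [:: r, t & ts].

Definition gatherable c m ts := exists2 us, heq c ts us & gathered m us.

Lemma gatherable_heq c m ts us : heq c ts us -> gatherable c m us -> gatherable c m ts.
Proof. by move=> tu [vs uv gv]; exists vs => //; apply: word_cong_trans uv. Qed.

Lemma fixesE m t : fixes m t -> sperm t m = m. Proof. by move/eqP. Qed.

Lemma spermKr t z : reflection t -> sperm t (sperm t z) = z.
Proof. by move=> tR; rewrite -permM -spermM reflectionK // sperm1 perm1. Qed.

Lemma fixes_conj m t r : reflection t -> fixes m t -> fixes m (t * r * t) = fixes m r.
Proof.
move=> tR mt; have tm := fixesE mt; rewrite /fixes !spermM !permM tm.
by rewrite -{2}tm (inj_eq perm_inj).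
Qed.

(** A letter fixing [m] moves past the letters moving [m] by conjugating them. *)
Lemma gather_fixing c m t us : reduced_word c (t :: us) -> fixes m t ->
  gathered m us -> gatherable c m (t :: us).
Proof.
move=> red mt gus; have tR := reduced_reflection red.
case: gus red => {us} [us mus|r us mr mus|r s us mr rs mus] red.
- by exists (t :: us); [apply: word_cong_refl | apply: Gathered0; rewrite /= mt].
- exists [:: t * r * t, t & us]; first exact: heq_swap.
  by apply: Gathered1; rewrite ?fixes_conj //= mt.
- have h1 := heq_swap red; have red1 := reduced_cons (heq_reduced h1 red).
  exists [:: t * r * t, t * s * t, t & us].
    by apply: word_cong_trans h1 (heq_cons _ (heq_swap red1)).
  by apply: Gathered2; rewrite ?fixes_conj //= ?mt // !spermM rs.
Qed.

Lemma reflection_tperm m t : reflection t -> ~~ fixes m t -> sperm t = tperm m (sperm t m).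
Proof. by move=> tR mt; have [_ /sperm_aswap] := reflection_moved tR mt. Qed.

(** Two letters swapping [m] with distinct residues are traded for one of them
    and a letter fixing [m], as in the symmetric group on three letters. *)
Lemma moving_conj_fixes m r t : reflection r -> reflection t ->
  ~~ fixes m r -> ~~ fixes m t -> sperm r <> sperm t -> fixes m (r * t * r).
Proof.
move=> rR tR mr mt rt.
have rE := reflection_tperm rR mr; have tE := reflection_tperm tR mt.
move: mr mt; rewrite /fixes !spermM !permM.
set a := sperm r m in rE *; set b := sperm t m in tE *; move=> am bm.
have ab : b != a by apply/eqP => ba; apply: rt; rewrite rE tE ba.
have -> : sperm t a = a by rewrite tE tpermD // eq_sym.
by rewrite /a spermKr.
Qed.

Lemma gather_moving1 c m t r us : reduced_word c [:: t, r & us] ->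
  ~~ fixes m t -> ~~ fixes m r -> sperm t <> sperm r -> all (fixes m) us ->
  gatherable c m [:: t, r & us].
Proof.
move=> red mt mr tr mus; have h := heq_swap red.
have tR := reduced_reflection red; have rR := reduced_reflection (reduced_cons red).
apply: (gatherable_heq h); apply: gather_fixing (heq_reduced h red) _ _.
  exact: moving_conj_fixes.
exact: Gathered1.
Qed.

Lemma reflection_offset t a b : reflection t -> a != b -> sperm t = tperm a b ->
  exists d, act t =1 aswap a b d.
Proof.
move=> tR ab tE; have ta : sperm t a != a by rewrite tE tpermL eq_sym.
by have [_] := reflection_moved tR ta; rewrite tE tpermL; exists (shift t a).
Qed.

(** The product of the last two is a translation by one period, so that they can
    be slid until they cancel the first. *)
Lemma no_three_parallel c t r s us : coxeter_element c ->
  reduced_word c [:: t, r, s & us] -> sperm t = sperm r -> sperm r = sperm s -> False.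
Proof.
move=> cox red tr rs; have tR := reduced_reflection red.
have red1 := reduced_cons red; have rR := reduced_reflection red1.
have red2 := @reduced_infix c [::] us [:: r; s] red1.
have rs1 : sperm (wprod [:: r; s]) = 1.
  by rewrite !wprod_cons wprod_nil mulg1 spermM -rs -spermM reflectionK // sperm1.
have [//|[_ [_ [[<- <-]]]]] := translation_divisor cox red2 rs1.
move=> [a [b [d [e [ab rE sE eE]]]]].
have [|d' tE] := reflection_offset tR ab; first by rewrite tr (sperm_aswap rE).
have [y h] := adjacent_slide ab rE sE eE red1 tE.
by have /reduced_neq := heq_reduced (heq_cons t h) red.
Qed.

Lemma gather_moving c m t us : coxeter_element c -> reduced_word c (t :: us) ->
  ~~ fixes m t -> gathered m us -> gatherable c m (t :: us).
Proof.
move=> cox red mt gus; have tR := reduced_reflection red.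
case: gus red => {us} [us mus|r us mr mus|r s us mr rs mus] red.
- by exists (t :: us); [apply: word_cong_refl | apply: Gathered1].
- have [tr|/eqP tr] := eqVneq (sperm t) (sperm r); last exact: gather_moving1.
  by exists [:: t, r & us]; [apply: word_cong_refl | apply: Gathered2].
- have [tr|/eqP tr] := eqVneq (sperm t) (sperm r).
    by case: (no_three_parallel cox red tr rs).
  have rR := reduced_reflection (reduced_cons red).
  have h := heq_swap red; have red1 := heq_reduced h red.
  have [||us' h' gus'] := gather_moving1 (reduced_cons red1) mt _ _ mus.
  + by rewrite /fixes -rs.
  + by rewrite -rs.
  have h2 := word_cong_trans h (heq_cons _ h').
  apply: (gatherable_heq h2); apply: gather_fixing (heq_reduced h2 red) _ gus'.
  exact: moving_conj_fixes.
Qed.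

Lemma gather c m ts : coxeter_element c -> reduced_word c ts -> gatherable c m ts.
Proof.
move=> cox; elim: ts => [|t ts IHts] red.
  by exists [::]; [apply: word_cong_refl | apply: Gathered0].
have [us h gus] := IHts (reduced_cons red).
have h' := heq_cons t h; have red' := heq_reduced h' red.
apply: (gatherable_heq h').
by have [mt|mt] := boolP (fixes m t); [apply: gather_fixing | apply: gather_moving].
Qed.

Lemma act_fixes m ts k : reflections ts -> all (fixes m) ts -> act (wprod ts) (m, k) = (m, k).
Proof.
elim: ts => [|t ts IHts]; first by rewrite wprod_nil act1.
case/reflections_cons=> tR tsR /= /andP[/fixesE mt mts].
by rewrite wprod_cons actM reflection_fixed // IHts.
Qed.

Lemma sperm_fixes m ts : reflections ts -> all (fixes m) ts -> sperm (wprod ts) m = m.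
Proof. by move=> tsR mts; rewrite -(act_fst _ (m, 0%R)) act_fixes. Qed.

(** * Transitivity of the Hurwitz moves *)

(** Two letters at the front, swapping [m] with the same residue, would bring [m]
    back to itself. *)
Lemma gathered_moving m ts : reflections ts -> gathered m ts -> sperm (wprod ts) m != m ->
  exists r us, [/\ ts = r :: us, ~~ fixes m r & all (fixes m) us].
Proof.
move=> tsR gts; case: gts tsR => {ts} [ts mts|r ts mr mts|r s ts mr rs mts] tsR.
- by rewrite sperm_fixes // eqxx.
- by exists r, ts.
- case/reflections_cons: tsR => rR /reflections_cons[sR tsR].
  by rewrite !wprod_cons !spermM -rs !permM spermKr // sperm_fixes // eqxx.
Qed.

(** The other letters fix [m], so that the product sends the image of [m] under
    its first letter to [m]. *)
Lemma first_letter_unique m r1 r2 us1 us2 :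
  reflections (r1 :: us1) -> reflections (r2 :: us2) ->
  wprod (r1 :: us1) = wprod (r2 :: us2) -> ~~ fixes m r1 -> ~~ fixes m r2 ->
  all (fixes m) us1 -> all (fixes m) us2 -> r1 = r2.
Proof.
case/reflections_cons=> r1R u1R /reflections_cons[r2R u2R] E m1 m2 f1 f2.
have act_rK r x : reflection r -> act r (act r x) = x.
  by move=> rR; rewrite -actM reflectionK // act1.
have m12 : act r1 (m, 0%R) = act r2 (m, 0%R).
  apply: (@act_inj (wprod (r1 :: us1))); rewrite {2}E !wprod_cons !actM.
  by rewrite !act_rK // !act_fixes.
have [_ E1] := reflection_moved r1R m1; have [_ E2] := reflection_moved r2R m2.
apply: act_faithful => x; rewrite E1 E2 /shift m12.
by rewrite -(act_fst r1 (m, 0%R)) -(act_fst r2 (m, 0%R)) m12.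
Qed.

(** If the divisor moves a residue [m], gathering the letters that move [m] makes
    the first letters of the two words agree; otherwise it is a translation. *)
Theorem hurwitz_transitive c ts us : coxeter_element c ->
  reduced_word c ts -> reduced_word c us -> wprod ts = wprod us -> heq c ts us.
Proof.
move=> cox; elim/ltn_ind: {ts}(size ts) {-2}ts (erefl (size ts)) us => k IHk ts tsk us.
move=> tsc usc E; have [m mE|fixall] := pickP (fun m => sperm (wprod ts) m != m).
  have [ts' hts gts] := gather m cox tsc; have [us' hus gus] := gather m cox usc.
  have [Et st _] := heq_invariant hts; have [Eu su _] := heq_invariant hus.
  have ts'c := heq_reduced hts tsc; have us'c := heq_reduced hus usc.
  have ts'R : reflections ts' by case: ts'c.
  have us'R : reflections us' by case: us'c.
  have [|r1 [us1 [E1 m1 f1]]] := gathered_moving ts'R gts; first by rewrite -Et.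
  have [|r2 [us2 [E2 m2 f2]]] := gathered_moving us'R gus; first by rewrite -Eu -E.
  rewrite {}E1 in ts'R ts'c hts Et st; rewrite {}E2 in us'R us'c hus Eu su.
  have E12 : wprod (r1 :: us1) = wprod (r2 :: us2) by rewrite -Et -Eu.
  have r12 := first_letter_unique ts'R us'R E12 m1 m2 f1 f2; subst r2.
  apply: word_cong_trans hts (word_cong_trans _ (word_cong_sym hus)); apply: heq_cons.
  apply: (IHk (size us1)) => //; first by rewrite -tsk st /=.
  - exact: reduced_cons ts'c.
  - exact: reduced_cons us'c.
  - by move: E12; rewrite !wprod_cons => /mulgI.
have ts1 : sperm (wprod ts) = 1.
  by apply/permP => m; rewrite perm1; have /negbFE/eqP := fixall m.
have [tsE|[r [t [tsE rt]]]] := translation_divisor cox tsc ts1.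
  have [_ _ lt] := tsc; have [_ _ lu] := usc.
  by move: lu; rewrite -E lt tsE /= => /esym/size0nil->; apply: word_cong_refl.
have us1 : sperm (wprod us) = 1 by rewrite -E.
have [usE|[r' [t' [usE _]]]] := translation_divisor cox usc us1.
  have [_ _ lt] := tsc; have [_ _ lu] := usc.
  by move: lu; rewrite -E lt tsE usE.
rewrite {}tsE {}usE in tsc usc E us1 *; move: rt => [a [b [d [e [ab rE tE eE]]]]].
have r'R := reduced_reflection usc; have t'R := reduced_reflection (reduced_cons usc).
rewrite !wprod_cons wprod_nil !mulg1 in E us1.
(* The letters of the two words move the same residues, namely those that the
   translation moves. *)
have moved z : act (r * t) (z, 0%R) != (z, 0%R) -> ~~ fixes z r'.
  apply: contraNN => r'z; have t'z : sperm t' z = z.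
    by rewrite -{1}(fixesE r'z) -permM -spermM us1 perm1.
  by rewrite E actM !reflection_fixed //; apply: fixesE.
have r'a : ~~ fixes a r'.
  apply: moved; rewrite actM rE tE aswapL aswapR // xpair_eqE eqxx /=.
  by case: eE => ->; lia.
have r'b : ~~ fixes b r'.
  apply: moved; rewrite actM rE tE aswapR // aswapL xpair_eqE eqxx /=.
  by case: eE => ->; lia.
have r'E : sperm r' = tperm a b.
  have r'E := reflection_tperm r'R r'a; suff -> : b = sperm r' a by [].
  by apply: contraNeq r'b => bc; rewrite /fixes r'E tpermD // eq_sym.
have [d' r'dE] := reflection_offset r'R ab r'E.
have [y h] := adjacent_slide ab rE tE eE tsc r'dE.
suff -> : t' = y by [].
have [] := heq_invariant h; rewrite !wprod_cons wprod_nil !mulg1 E.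
by move/mulgI.
Qed.

End AffineAction.

(** * The dual monoid *)

Section DualMonoid.
Local Open Scope group_scope.
Variables (n : nat) (n_gt1 : (1 < n)%N) (c : affineA n).
Hypothesis cox : coxeter_element c.
Implicit Types (ts us : seq (affineA n)).

Local Notation R := (refl_divisors c).
Local Notation P := (Defs.divisors c).

(** The letters of a reduced word of a divisor all are reflections dividing [c];
    so that [insub] drops none of them. *)
Definition rword ts : seq R := pmap insub ts.

Lemma rword_val (rs : seq R) : rword [seq val r | r <- rs] = rs.
Proof. by elim: rs => //= r rs IHrs; rewrite /rword /= valK /= -/(rword _) IHrs. Qed.

Lemma refl_divisor_val (t : affineA n) : reflection t /\ divides t c ->
  exists r : R, t = val r.
Proof. by move/mem_set=> tin; exists (exist _ t tin). Qed.

Lemma reduced_rword ts : reduced_word c ts -> exists rs : seq R, ts = [seq val r | r <- rs].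
Proof.
move=> red; have: forall t, t \in ts -> t \in R.
  by move=> t tts; apply/mem_set; exact: (reduced_letter n_gt1 red tts).
elim: ts {red} => [|t ts IHts] tsR; first by exists [::].
have [|rs ->] := IHts; first by move=> u uts; apply: tsR; rewrite inE uts orbT.
by exists (exist _ t (tsR t (mem_head _ _)) :: rs).
Qed.

Lemma reduced_pair (r t : affineA n) : reflection r -> reflection t -> r <> t ->
  divides (r * t) c -> reduced_word c [:: r; t].
Proof.
move=> rR tR rt rtc; rewrite /reduced_word !wprod_cons wprod_nil mulg1; split=> //.
  by do 2![apply/reflections_cons; split=> //].
exact: lR_pair.
Qed.

Lemma rword_cong ts us : word_cong (@hurwitz_move n c) ts us ->
  word_cong (@hurwitz_rel n c) (rword ts) (rword us).
Proof.
elim=> {ts us} [a b _ _ [r t rR tR rt rtc]|ts|ts us _ h|ts us vs _ h _ h'].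
- rewrite /rword !pmap_cat; apply: word_cong_cat; first exact: word_cong_refl.
  apply: word_cong_cat; last exact: word_cong_refl.
  have red := reduced_pair rR tR rt rtc.
  have red' := heq_reduced (heq_swap n_gt1 red) red.
  have [r0 rE] : exists r0 : R, r = val r0.
    by apply: refl_divisor_val; apply: (reduced_letter n_gt1 red); rewrite mem_head.
  have [t0 tE] : exists t0 : R, t = val t0.
    by apply: refl_divisor_val; apply: (reduced_letter n_gt1 red); rewrite !inE eqxx orbT.
  have [q0 qE] : exists q0 : R, r * t * r = val q0.
    by apply: refl_divisor_val; apply: (reduced_letter n_gt1 red'); rewrite mem_head.
  rewrite qE rE tE -!/(rword _) (rword_val [:: r0; t0]) (rword_val [:: q0; r0]).
  apply: (@word_cong_rel _ _ [::] [::] [:: r0; t0] [:: q0; r0]); apply: Hurwitz_rel.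
  + by move=> rt0; apply: rt; rewrite rE tE rt0.
  + by rewrite -rE -tE.
  + by rewrite -qE rE tE.
- exact: word_cong_refl.
- exact: word_cong_sym.
- exact: word_cong_trans h h'.
Qed.

(** Suffixes of a reduced word are divisors as well, so that the letters can be
    multiplied together one at a time. *)
Lemma dual_gen_word (rs : seq R) (w : P) :
  reduced_word c [seq val r | r <- rs] -> val w = wprod [seq val r | r <- rs] ->
  \prod_(r <- rs) dual_gen (refl_divisor_in r) = dual_gen w.
Proof.
elim: rs w => [|r rs IHrs] w red wE.
  rewrite big_nil; apply/esym/pwordP.
  by apply: (@word_cong_rel _ _ [::] [::] [:: w] [::]); apply: dual_rel_unit; rewrite wE wprod_nil.
have red' : reduced_word c [seq val r | r <- rs] := reduced_cons n_gt1 red.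
have wc' : wprod [seq val r | r <- rs] \in P by apply/mem_set; case: red'.
pose w' : P := exist _ (wprod [seq val r | r <- rs]) wc'.
rewrite big_cons (IHrs w' red' erefl) -[LHS]pwordM; apply/pwordP.
apply: (@word_cong_rel _ _ [::] [::] [:: _; _] [:: w]); apply: dual_rel_mul.
  by rewrite wE /= wprod_cons.
have [rR _] := reduced_letter n_gt1 red (mem_head _ _).
have [_ _] := red; have [_ _] := red'; rewrite wE /= => -> ->.
by rewrite lR_reflection.
Qed.

(** Both sides of a Hurwitz relation are reduced words of the same divisor. *)
Lemma hurwitz_rel_dual (u v : seq R) : hurwitz_rel u v ->
  \prod_(r <- u) dual_gen (refl_divisor_in r) = \prod_(r <- v) dual_gen (refl_divisor_in r).
Proof.
case=> r t q rt rtc qE.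
have [[rR _] [tR _]] := (set_mem (valP r), set_mem (valP t)).
have rtv : val r <> val t by move/val_inj.
have red := reduced_pair rR tR rtv rtc.
have rtc' : val r * val t \in P by apply/mem_set.
pose w : P := exist _ (val r * val t) rtc'.
rewrite (@dual_gen_word [:: r; t] w) //; last by rewrite !wprod_cons wprod_nil mulg1.
have h := heq_swap n_gt1 red; have [hE _ _] := heq_invariant h.
have red' := heq_reduced h red.
rewrite (@dual_gen_word [:: q; r] w) //=; first by rewrite qE.
by rewrite qE -hE !wprod_cons wprod_nil mulg1.
Qed.

Definition divisor_word (w : P) : seq (affineA n) :=
  sval (cid2 (reduced_exists (set_mem (valP w)))).

Lemma divisor_wordP w : reduced_word c (divisor_word w) /\ val w = wprod (divisor_word w).
Proof. by rewrite /divisor_word; case: cid2. Qed.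

Definition hurwitz_gen (w : P) : pmonoid (@hurwitz_rel n c) :=
  pword _ (rword (divisor_word w)).

(** Transitivity of the Hurwitz moves makes this independent of the chosen word. *)
Lemma hurwitz_genE (w : P) (rs : seq R) :
  reduced_word c [seq val r | r <- rs] -> val w = wprod [seq val r | r <- rs] ->
  hurwitz_gen w = pword _ rs.
Proof.
move=> red wE; have [redw wE'] := divisor_wordP w.
apply/pwordP; rewrite -[X in word_cong _ _ X]rword_val; apply: rword_cong.
by apply: hurwitz_transitive => //; rewrite -wE -wE'.
Qed.

Lemma dual_rel_hurwitz (u v : seq P) : dual_rel u v ->
  \prod_(w <- u) hurwitz_gen w = \prod_(w <- v) hurwitz_gen w.
Proof.
case=> [e e1|w w' ww' E l].
  have [[_ _ l0] eE] := divisor_wordP e.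
  rewrite big_seq1 big_nil /hurwitz_gen; move: l0; rewrite -eE e1 lR1.
  by move/esym/size0nil=> ->.
have [redw wE] := divisor_wordP w; have [redw' wE'] := divisor_wordP w'.
have [rs rsE] := reduced_rword redw; have [rs' rsE'] := reduced_rword redw'.
rewrite !big_cons !big_nil !mulg1 (@hurwitz_genE ww' (rs ++ rs')); first last.
- by rewrite map_cat wprod_cat -rsE -rsE' -wE -wE'.
- rewrite map_cat -rsE -rsE'; case: redw => wR _ wl; case: redw' => w'R _ w'l.
  rewrite /reduced_word wprod_cat -wE -wE' -E; split.
  + by apply/reflections_cat.
  + exact: (set_mem (valP ww')).
  + by rewrite l size_cat wE wE' wl w'l.
by rewrite /hurwitz_gen rsE rsE' !rword_val -pwordM.
Qed.

Lemma hurwitz_gen_refl (r : R) : hurwitz_gen (refl_divisor_in r) = pgen _ r.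
Proof.
have [rR rc] := set_mem (valP r).
rewrite (@hurwitz_genE _ [:: r]) //= ?wprod_cons ?wprod_nil ?mulg1 //.
rewrite /reduced_word wprod_cons wprod_nil mulg1 lR_reflection //; split=> //.
by apply/reflections_cons.
Qed.

(** The two lifts are mutually inverse, as they are so on generators. *)
Lemma presented_by_hurwitz_rel :
  presented_by (fun r : R => dual_gen (refl_divisor_in r)) (@hurwitz_rel n c).
Proof.
pose phi := @pmonoid_lift _ (@hurwitz_rel n c) _ (fun r : R => dual_gen (refl_divisor_in r)).
pose psi := @pmonoid_lift _ (@dual_rel n c) _ hurwitz_gen.
have phiM : monoid.monoid_morphism phi := pmonoid_lift_morphism hurwitz_rel_dual.
have psiM : monoid.monoid_morphism psi := pmonoid_lift_morphism dual_rel_hurwitz.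
have phi_gen r : phi (pgen _ r) = dual_gen (refl_divisor_in r).
  exact: (pmonoid_lift_gen hurwitz_rel_dual).
have psi_gen w : psi (dual_gen w) = hurwitz_gen w.
  exact: (pmonoid_lift_gen dual_rel_hurwitz).
exists phi; split=> //; exists psi.
- apply: (pmonoid_morphism_id (monoid_morphism_comp phiM psiM)) => r /=.
  by rewrite phi_gen psi_gen hurwitz_gen_refl.
- apply: (pmonoid_morphism_id (monoid_morphism_comp psiM phiM)) => w /=.
  rewrite -/(dual_gen w) psi_gen /hurwitz_gen.
  have [redw wE] := divisor_wordP w; have [rs rsE] := reduced_rword redw.
  rewrite rsE in redw wE *; rewrite rword_val.
  by rewrite /phi (pmonoid_lift_pword hurwitz_rel_dual) (dual_gen_word redw wE).
Qed.

End DualMonoid.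

Theorem proposition3p4 (n : nat) (hn : 2 <= n) (c : affineA n)
    (hc : coxeter_element c) :
  presented_by (fun r : refl_divisors c => dual_gen (refl_divisor_in r))
    (@hurwitz_rel n c).
Proof. exact: presented_by_hurwitz_rel. Qed.
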